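(* For $t>0$ and an integer $m\ge 1$, let $$P_{t,m}(z)=\sum_{k=0}^m \frac{t^k}{k!}z^k \quad\text{and}\quad Q_{t,m}(z)=\sum_{k=0}^m \frac{(-1)^k t^k}{k!}z^k$$ be the $m$-th order Taylor polynomials at $0$ of $e^{tz}$ and $e^{-tz}$, respectively, regarded as elements of $\mathbb{C}[z]$ (one variable), and let $\|\cdot\|_a$ denote the apolar norm on $\mathbb{C}[z]$. Then for every fixed $t>0$, $$\lim_{m\to\infty}\|P_{t,m}Q_{t,m}\|_a=1 \quad\text{and}\quad \lim_{m\to\infty}\|P_{t,m}\|_a\,\|Q_{t,m}\|_a=e^{t^2}.$$ Consequently, there is no absolute constant $C>0$ such that the inequality $$C\,\|P_{t,m}Q_{t,m}\|_a\ \ge\ \|P_{t,m}\|_a\,\|Q_{t,m}\|_a$$ holds for every $t>0$ and every integer $m\ge 1$.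
   Context: The apolar inner product on $\mathbb{C}[z]$ (polynomials in one variable with complex coefficients) is defined, for $P(z)=\sum_{k} c_k z^k$ and $Q(z)=\sum_{k} d_k z^k$ (finite sums), by $$\langle P,Q\rangle_a := \sum_{k\ge 0} k!\,c_k\,\overline{d_k}.$$ Equivalently, $\langle P,Q\rangle_a=(Q^*(D)P)(0)$, where $Q^*$ is obtained from $Q$ by conjugating its coefficients and $Q^*(D)$ is the differential operator obtained from $Q^*$ by replacing $z$ with $\frac{d}{dz}$. The apolar norm is $\|P\|_a:=\sqrt{\langle P,P\rangle_a}$. *)

(* Defs.v *)
From HB Require Import structures.
From mathcomp Require Import all_boot all_order all_algebra.
From mathcomp Require Import complex.
From mathcomp Require Import all_classical all_reals all_analysis.

Set Implicit Arguments.
Unset Strict Implicit.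
Unset Printing Implicit Defensive.

Import Order.TTheory GRing.Theory Num.Theory.
Import numFieldNormedType.Exports.

Local Open Scope ring_scope.
Local Open Scope complex_scope.

(* The finite bound loses nothing: p`_k = 0 for k >= size p
   (see apolar_widen below). *)
Definition apolar (R : realType) (p q : {poly R[i]}) : R[i] :=
  \sum_(k < maxn (size p) (size q)) (k`!)%:R * p`_k * (q`_k)^*.

(* apolar p p is a nonnegative real (see apolar_normE below), so taking its
   real part only changes the type from R[i] to R. *)
Definition apolar_norm (R : realType) (p : {poly R[i]}) : R :=
  Num.sqrt (complex.Re (apolar p p)).

Definition taylorP (R : realType) (t : R) (m : nat) : {poly R[i]} :=
  \poly_(k < m.+1) (t ^+ k / (k`!)%:R)%:C.

Definition taylorQ (R : realType) (t : R) (m : nat) : {poly R[i]} :=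
  \poly_(k < m.+1) ((-1) ^+ k * t ^+ k / (k`!)%:R)%:C.

Lemma apolar_widen (R : realType) (p q : {poly R[i]}) (n : nat) :
  (maxn (size p) (size q) <= n)%N ->
  apolar p q = \sum_(k < n) (k`!)%:R * p`_k * (q`_k)^*.
Proof.
move=> le_n; rewrite /apolar.
rewrite (big_ord_widen n (fun k => (k`!)%:R * p`_k * (q`_k)^*)) // big_mkcond.
apply: eq_bigr => k _; case: ltnP => // le_k.
rewrite (@nth_default _ _ p) ?mulr0 ?mul0r //.
exact: leq_trans (leq_maxl _ _) le_k.
Qed.

Lemma apolar_ge0 (R : realType) (p : {poly R[i]}) : 0 <= apolar p p.
Proof.
apply: sumr_ge0 => k _; rewrite -mulrA mulr_ge0 ?ler0n //.
exact: mul_conjC_ge0.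
Qed.

Lemma apolar_normE (R : realType) (p : {poly R[i]}) :
  (apolar_norm p)%:C ^+ 2 = apolar p p.
Proof.
have := apolar_ge0 p; rewrite /apolar_norm.
case: (apolar p p) => a b; rewrite lecE /= => /andP[/eqP-> a_ge0].
by rewrite -rmorphXn /= sqr_sqrtr.
Qed.

(* Main.v *)
Require Import Defs.
From HB Require Import structures.
From mathcomp Require Import all_boot all_order all_algebra.
From mathcomp Require Import complex.
From mathcomp Require Import all_classical all_reals all_analysis.
From mathcomp Require Import ring lra.
Import Order.TTheory GRing.Theory Num.Theory.
Import numFieldNormedType.Exports.
Local Open Scope classical_set_scope.
Local Open Scope ring_scope.

(** Both limits are instances of one: for all real [x] and [y], the apolar norm
    of [taylorP x m * taylorP y m] tends to the square root of
    [expR ((x + y) ^+ 2)] (lemma [cvg_apolar_norm_taylorM]).  Since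
    [taylorQ t m] is [taylorP (- t) m], taking [y = - x] gives the limit 1 for
    the product; since [taylorP 0 m = 1], taking [y = 0] gives the norm of a
    single factor, and the two factors, with parameters [t] and [- t], have the
    same limit, the square root of [expR (t ^+ 2)].

    The general limit compares the coefficients of the product with those of
    the series of exp ((x + y) z).  Up to degree [m] they agree, because
    truncation does not affect the Cauchy product there; each degree [k]
    contributes k! ((x + y) ^ k / k!) ^ 2 = (x + y) ^ (2 k) / k! to the square
    of the norm, and these terms form a partial sum of exp ((x + y) ^ 2).
    Beyond degree [m] the coefficients are still bounded by
    (|x| + |y|) ^ k / k!, so that their contribution is at most a tail of the
    series of exp ((|x| + |y|) ^ 2), which tends to 0.

    A constant [C] as in the last claim would, by passing to the limit in [m],
    bound [expR (t ^+ 2)] for every [t > 0], which is impossible. *)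

Lemma apolar_norm_real {R : realType} (p : {poly R[i]}) (a : nat -> R)
    (n : nat) :
  (size p <= n)%N -> (forall k, p`_k = (a k)%:C%C) ->
  apolar_norm p = Num.sqrt (\sum_(0 <= k < n) (k`!)%:R * a k ^+ 2).
Proof.
move=> sz_p pE; rewrite /apolar_norm (@apolar_widen _ _ _ n) ?maxnn//.
congr (Num.sqrt _); rewrite big_mkord.
under eq_bigr => k _.
  rewrite pE conj_Creal ?complex_real// -mulrA -rmorphM.
  rewrite -(rmorph_nat (real_complex R)) -rmorphM /=.
  over.
by rewrite -rmorph_sum.
Qed.

Lemma taylorQE {R : realType} (t : R) (m : nat) : taylorQ t m = taylorP (- t) m.
Proof.
by apply/polyP => k; rewrite !coef_poly -exprNn.
Qed.

Lemma taylorP0 {R : realType} (m : nat) : taylorP (0 : R) m = 1.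
Proof.
apply/polyP => k; rewrite coef_poly coef1.
case: k => [|k] /=; first by rewrite expr0 fact0 divr1.
by rewrite expr0n mul0r if_same.
Qed.

(** The binomial theorem divided by k!: the Cauchy product of two exponential
    series. *)
Lemma exp_coeffD {R : realType} (x y : R) (k : nat) :
  exp_coeff (x + y) k = \sum_(j < k.+1) exp_coeff x j * exp_coeff y (k - j)%N.
Proof.
rewrite /exp_coeff/= addrC exprDn mulr_suml; apply: eq_bigr => j _.
have jk : (j <= k)%N by rewrite -ltnS.
rewrite -(bin_fact jk) !natrM -[_ *+ 'C(k, j)]mulr_natr.
have f_neq0 i : (i`!)%:R != 0 :> R by rewrite pnatr_eq0 -lt0n fact_gt0.
have b_neq0 : 'C(k, j)%:R != 0 :> R by rewrite pnatr_eq0 -lt0n bin_gt0.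
have f_j := f_neq0 j; have f_kj := f_neq0 (k - j)%N.
by field; rewrite b_neq0 f_j f_kj.
Qed.

(** The Cauchy product of [exp_coeff x] and [exp_coeff y] with both sequences
    cut off after index [m], that is, the coefficients of
    [taylorP x m * taylorP y m]. *)
Definition taylor_conv {R : realType} (x y : R) (m k : nat) : R :=
  \sum_(j < k.+1 | (j <= m)%N && (k - j <= m)%N)
     exp_coeff x j * exp_coeff y (k - j)%N.

Lemma coef_taylorM {R : realType} (x y : R) (m k : nat) :
  (taylorP x m * taylorP y m)`_k = (taylor_conv x y m k)%:C%C.
Proof.
rewrite coefM /taylor_conv rmorph_sum [RHS]big_mkcond /=.
apply: eq_bigr => j _; rewrite !coef_poly !ltnS.
by case: ifP => _; case: ifP => _ /=; rewrite ?mulr0 ?mul0r ?rmorphM.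
Qed.

(** For [k <= m] the truncation removes no term of the Cauchy product. *)
Lemma taylor_conv_le {R : realType} (x y : R) (m k : nat) :
  (k <= m)%N -> taylor_conv x y m k = exp_coeff (x + y) k.
Proof.
move=> km; rewrite exp_coeffD; apply: eq_bigl => j.
by rewrite (leq_trans (leq_subr _ _))// (leq_trans _ km)// -ltnS.
Qed.

(** The triangle inequality turns the truncated sum into part of the full
    Cauchy product for [`|x|] and [`|y|]. *)
Lemma norm_taylor_conv {R : realType} (x y : R) (m k : nat) :
  `|taylor_conv x y m k| <= exp_coeff (`|x| + `|y|) k.
Proof.
have normE (z : R) i : `|exp_coeff z i| = exp_coeff `|z| i.
  by rewrite /exp_coeff/= normrM normrX normfV normr_nat.
rewrite exp_coeffD (le_trans (ler_norm_sum _ _ _))//.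
rewrite [leLHS]big_mkcond ler_sum// => j _; rewrite -!normE -normrM.
by case: ifP.
Qed.

(** With the weights k! of the apolar norm, squaring exponential coefficients
    yields exponential coefficients again; this is what makes the squared norm
    a partial sum of an exponential series. *)
Lemma fact_sqr_exp_coeff {R : realType} (x : R) (k : nat) :
  (k`!)%:R * exp_coeff x k ^+ 2 = exp_coeff (x ^+ 2) k.
Proof.
have f_neq0 : (k`!)%:R != 0 :> R by rewrite pnatr_eq0 -lt0n fact_gt0.
by rewrite /exp_coeff/= exprMn exprAC mulrCA expr2 mulVKf // expr2 mulKVf.
Qed.

Lemma cvg_series_exp_coeff {R : realType} (x : R) :
  series (exp_coeff x) @ \oo --> expR x.
Proof. exact: is_cvg_series_exp_coeff. Qed.

Lemma series_exp_coeff_le {R : realType} (x : R) (n : nat) :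
  0 <= x -> series (exp_coeff x) n <= expR x.
Proof.
move=> x_ge0; apply: nondecreasing_cvgn_le (is_cvg_series_exp_coeff x) n.
by apply: nondecreasing_series => k _ _; exact: exp_coeff_ge0.
Qed.

(** The squared norm is squeezed between the partial sum of exp ((x + y) ^ 2)
    coming from the degrees up to [m], and the same plus the whole tail of
    exp ((|x| + |y|) ^ 2) after degree [m]. *)
Lemma cvg_apolar_norm_taylorM {R : realType} (x y : R) :
  (fun m : nat => apolar_norm (taylorP x m * taylorP y m)) @ \oo
    --> Num.sqrt (expR ((x + y) ^+ 2)).
Proof.
set r := (`|x| + `|y|) ^+ 2; set s := (x + y) ^+ 2.
pose N m : R := \sum_(0 <= k < m.+1 + m.+1) (k`!)%:R * taylor_conv x y m k ^+ 2.
have normE : (fun m => apolar_norm (taylorP x m * taylorP y m)) =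
    Num.sqrt \o N.
  apply/funext => m /=; apply: apolar_norm_real => [|k].
    rewrite (leq_trans (size_polyMleq _ _))// (leq_trans (leq_pred _))//.
    by rewrite leq_add// size_poly.
  exact: coef_taylorM.
rewrite normE; apply: continuous_cvg; first exact: sqrt_continuous.
pose low m := series (exp_coeff s) m.+1.
have low_cvg : low @ \oo --> expR s.
  by rewrite (cvg_shiftS (series (exp_coeff s))); exact: cvg_series_exp_coeff.
pose tail m := expR r - series (exp_coeff r) m.+1.
have tail_cvg : tail @ \oo --> (0 : R).
  rewrite -(subrr (expR r)); apply: cvgB; first exact: cvg_cst.
  by rewrite (cvg_shiftS (series (exp_coeff r))); exact: cvg_series_exp_coeff.
apply: (@squeeze_cvgr _ _ _ _ low (low \+ tail)) => //; last first.
  by rewrite -[X in _ --> X]addr0; exact: cvgD.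
apply: nearW => m /=.
have NE : N m = low m +
    \sum_(m.+1 <= k < m.+1 + m.+1) (k`!)%:R * taylor_conv x y m k ^+ 2.
  rewrite /N (@big_cat_nat _ _ _ m.+1)//= ?leq_addr//; congr (_ + _).
  apply: eq_big_nat => k /andP[_ km].
  by rewrite taylor_conv_le// fact_sqr_exp_coeff.
rewrite NE lerDl lerD2l; apply/andP; split.
  by apply: sumr_ge0 => k _; rewrite mulr_ge0// sqr_ge0.
rewrite /tail lerBrDr addrC.
apply: le_trans (series_exp_coeff_le _ (m.+1 + m.+1) (sqr_ge0 (`|x| + `|y|))).
rewrite /series/= [leRHS](@big_cat_nat _ _ _ m.+1)//= ?leq_addr// lerD2l.
apply: ler_sum => k _; rewrite -/r -fact_sqr_exp_coeff ler_wpM2l//.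
rewrite -real_normK ?num_real//.
by rewrite lerXn2r ?nnegrE ?norm_taylor_conv// exp_coeff_ge0 ?addr_ge0.
Qed.

Lemma cvg_apolar_norm_taylor {R : realType} (x : R) :
  (fun m : nat => apolar_norm (taylorP x m)) @ \oo
    --> Num.sqrt (expR (x ^+ 2)).
Proof.
rewrite -[in X in _ --> X](addr0 x).
under eq_fun => m do rewrite -[taylorP x m]mulr1 -(taylorP0 m).
exact: cvg_apolar_norm_taylorM.
Qed.

Theorem mainTheorem1 (R : realType) :
  (forall t : R, 0 < t ->
     (fun m : nat => apolar_norm (taylorP t m * taylorQ t m)) @ \oo --> (1 : R)
     /\
     (fun m : nat => apolar_norm (taylorP t m) * apolar_norm (taylorQ t m))
       @ \oo --> expR (t ^+ 2))
  /\
  ~ (exists C : R, 0 < C /\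
      forall (t : R) (m : nat), 0 < t -> (1 <= m)%N ->
        C * apolar_norm (taylorP t m * taylorQ t m)
          >= apolar_norm (taylorP t m) * apolar_norm (taylorQ t m)).
Proof.
have limits (t : R) :
    (fun m : nat => apolar_norm (taylorP t m * taylorQ t m)) @ \oo --> (1 : R)
    /\
    (fun m : nat => apolar_norm (taylorP t m) * apolar_norm (taylorQ t m))
      @ \oo --> expR (t ^+ 2).
  split; under eq_fun do rewrite taylorQE.
    have := cvg_apolar_norm_taylorM t (- t).
    by rewrite subrr expr0n expR0 sqrtr1.
  rewrite -[expR _]sqr_sqrtr ?expR_ge0// expr2.
  apply: cvgM; first exact: cvg_apolar_norm_taylor.
  by rewrite -sqrrN; exact: cvg_apolar_norm_taylor.
split=> [t _|[C [C_gt0 bound]]]; first exact: limits.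
(* t = C + 1 is a choice for which expR (t ^+ 2) >= 1 + t ^+ 2 > C. *)
have t_gt0 : 0 < C + 1 by rewrite addr_gt0.
have [normPQ normP_normQ] := limits (C + 1).
have : expR ((C + 1) ^+ 2) <= C * 1.
  apply: (ler_cvg_to normP_normQ (cvgM (cvg_cst C) normPQ)).
  near=> m; apply: bound => //; near: m; exact: nbhs_infty_ge.
apply/negP; rewrite -ltNge mulr1.
apply: lt_le_trans (expR_ge1Dx _).
nra.
Unshelve. all: by end_near. Qed.
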